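(* Let $\mathcal{G}$ be an \'etale groupoid with the Fourier coefficients approximation property. If $I$ is a closed two-sided ideal of $C_r^*(\mathcal{G})$, then $A(\sigma(I))$ is the smallest dynamical ideal of $C_r^*(\mathcal{G})$ containing $I$. Moreover, $I$ is spectral as a diagonal bimodule if and only if $I$ is a dynamical ideal. Hence the map $\mathcal{H}\mapsto A(\mathcal{H})$ gives a one-to-one correspondence between the open subgroupoids $\mathcal{H}$ of $\mathcal{G}$ which are invariant under the multiplication and the dynamical ideals of $C_r^*(\mathcal{G})$.
   Context: An \'etale groupoid means a second countable, locally compact, Hausdorff topological groupoid $\mathcal{G}$ whose range and source maps $r,s:\mathcal{G}\to\mathcal{G}^{(0)}$ are local homeomorphisms; $\mathcal{G}^{(0)}$ is the unit space and $\mathcal{G}_u=s^{-1}(u)$. $C_c(\mathcal{G})$ is a $*$-algebra with $f^*(\gamma)=\overline{f(\gamma^{-1})}$ and $(fg)(\gamma)=\sum_{\gamma'\in\mathcal{G}_{s(\gamma)}}f(\gamma\gamma'^{-1})g(\gamma')$; $C_r^*(\mathcal{G})$ is its completion in the norm $\|f\|_{\mathrm{red}}=\sup_{u\in\mathcal{G}^{(0)}}\|\mathrm{Ind}_u(f)\|$, where $\mathrm{Ind}_u(f)\xi(\gamma)=\sum_{\gamma'\in\mathcal{G}_u}f(\gamma\gamma'^{-1})\xi(\gamma')$ on $\ell^2(\mathcal{G}_u)$. The inclusion $C_c(\mathcal{G})\subseteq C_0(\mathcal{G})$ extends to a norm-decreasing injective linear map $j:C_r^*(\mathcal{G})\to C_0(\mathcal{G})$,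 and each $a\in C_r^*(\mathcal{G})$ is identified with the function $j(a)$; write $a(\gamma)=j(a)(\gamma)$ and $\mathrm{supp}'(a)=\{\gamma\in\mathcal{G}:a(\gamma)\neq0\}$. $C_0(\mathcal{G}^{(0)})$ is regarded as a $C^*$-subalgebra of $C_r^*(\mathcal{G})$. For open $P\subseteq\mathcal{G}$, $C_c(P)\subseteq C_c(\mathcal{G})$ via extension by zero. A diagonal bimodule of $C_r^*(\mathcal{G})$ is a norm closed subspace $M$ such that $ab,ba\in M$ for all $a\in M$, $b\in C_0(\mathcal{G}^{(0)})$; every closed two-sided ideal is one. Its spectrum is $\sigma(M)=\{\gamma\in\mathcal{G}:a(\gamma)\ne0\text{ for some }a\in M\}$. For open $P\subseteq\mathcal{G}$, $A(P)=\{a\in C_r^*(\mathcal{G}):a(\gamma)=0\text{ for all }\gamma\notin P\}$ (so $A(\emptyset)=\{0\}$). $M$ is spectral if $M=A(\sigma(M))$. $\mathcal{G}$ has the Fourier coefficients approximation property if $a\in\overline{C_c(\mathrm{supp}'(a))}$ (closure in the reduced norm) for all $a\in C_r^*(\mathcal{G})$. A subset $U\subseteq\mathcal{G}^{(0)}$ is invariant if $U=r(s^{-1}(U))$; $\mathcal{G}|_U=s^{-1}(U)\cap r^{-1}(U)$. For open invariant $U$, $C_r^*(\mathcal{G}|_U)$ is identified with the closure of $C_c(\mathcal{G}|_U)$ in $C_r^*(\mathcal{G})$. A closed two-sided ideal $I$ of $C_r^*(\mathcal{G})$ is a dynamical ideal if $I=C_r^*(\mathcal{G}|_U)$ for some open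 invariant $U\subseteq\mathcal{G}^{(0)}$. A subgroupoid $\mathcal{H}\subseteq\mathcal{G}$ is invariant under the multiplication if $\mathcal{H}\mathcal{G}\subseteq\mathcal{H}$ and $\mathcal{G}\mathcal{H}\subseteq\mathcal{H}$, where for subsets $A,B$ of $\mathcal{G}$, $AB=\{\alpha\beta:\alpha\in A,\beta\in B,s(\alpha)=r(\beta)\}$. The empty set is allowed as an open subgroupoid and as an open invariant set (corresponding to the zero ideal). *)

(* Defs.v *)
From HB Require Import structures.
From mathcomp Require Import all_boot all_order all_algebra.
From mathcomp Require Import complex.
From mathcomp Require Import all_classical all_reals all_analysis.
Import Order.TTheory GRing.Theory Num.Theory.
Import numFieldNormedType.Exports.

Set Implicit Arguments.
Unset Strict Implicit.
Unset Printing Implicit Defensive.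

Local Open Scope classical_set_scope.
Local Open Scope ring_scope.

(* R[i] as a numClosedFieldType, so that it carries the norm topology. *)
Definition cplx (R : realType) : numClosedFieldType := (R[i])%C.

(* |z| is an element of R[i]; this is the same number in R, also for the
   R[i]-valued norm of a normed module. *)
Definition rnorm (R : realType) (V : normedModType (cplx R)) (v : V) : R :=
  complex.Re `|v|.
Definition modulus (R : realType) (z : cplx R) : R := complex.Re `|z|.

Section Topology.
Variable T : topologicalType.

Definition rel_open (Y V : set T) := exists2 W, open W & V = W `&` Y.

(* Every point has an open neighbourhood that f maps homeomorphically onto an
   open subset of Y (f @` U is relatively open by the case V = U). *)
Definition local_homeo (Y : set T) (f : T -> T) :=
  (forall x, Y (f x)) /\
  forall x, exists U : set T,
    [/\ open U, U x, set_inj U f, {within U, continuous f} &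
        forall V : set T, open V -> V `<=` U -> rel_open Y (f @` V)].

End Topology.

(* The type is the set of arrows and the units are arrows. The product is a
   total function whose values on non-composable pairs are unconstrained. *)
Record groupoid := Groupoid {
  arrow :> topologicalType;
  src : arrow -> arrow;
  rng : arrow -> arrow;
  gmul : arrow -> arrow -> arrow;
  ginv : arrow -> arrow;
  src_src : forall g, src (src g) = src g;
  rng_src : forall g, rng (src g) = src g;
  src_rng : forall g, src (rng g) = rng g;
  rng_rng : forall g, rng (rng g) = rng g;
  src_mul : forall g h, src g = rng h -> src (gmul g h) = src h;
  rng_mul : forall g h, src g = rng h -> rng (gmul g h) = rng g;
  gmulA : forall g h k, src g = rng h -> src h = rng k ->
    gmul g (gmul h k) = gmul (gmul g h) k;
  gmul_unitl : forall g, gmul (rng g) g = g;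
  gmul_unitr : forall g, gmul g (src g) = g;
  src_inv : forall g, src (ginv g) = rng g;
  rng_inv : forall g, rng (ginv g) = src g;
  gmulV : forall g, gmul g (ginv g) = rng g;
  gmulVg : forall g, gmul (ginv g) g = src g
}.

Section Groupoid.
Variable G : groupoid.

Definition units : set G := range (@src G).

Definition composable : set (G * G) := [set p | src p.1 = rng p.2].

Definition fiber (u : G) : set G := [set g | src g = u].

Definition topological_groupoid :=
  {within composable, continuous (fun p : G * G => gmul p.1 p.2)} /\
  continuous (@ginv G).

Definition gprod (A B : set G) : set G :=
  [set g | exists a b, [/\ A a, B b, src a = rng b & g = gmul a b]].

Definition subgroupoid (H : set G) :=
  (forall g h, H g -> H h -> src g = rng h -> H (gmul g h)) /\
  (forall g, H g -> H (ginv g)).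

Definition mul_invariant (H : set G) :=
  gprod H setT `<=` H /\ gprod setT H `<=` H.

Definition invariant (U : set G) :=
  U `<=` units /\ U = (@rng G) @` ((@src G) @^-1` U).

Definition reduction (U : set G) : set G :=
  (@src G) @^-1` U `&` (@rng G) @^-1` U.

End Groupoid.

Arguments units : clear implicits.

Record etaleGroupoid := EtaleGroupoid {
  eg_groupoid :> groupoid;
  eg_second_countable : @second_countable eg_groupoid;
  eg_locally_compact : locally_compact [set: eg_groupoid];
  eg_hausdorff : hausdorff_space eg_groupoid;
  eg_topological : topological_groupoid eg_groupoid;
  eg_rng_local_homeo : local_homeo (units eg_groupoid) (@rng eg_groupoid);
  eg_src_local_homeo : local_homeo (units eg_groupoid) (@src eg_groupoid)
}.

Section Functions.
Variables (R : realType) (G : etaleGroupoid).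
Implicit Types (f g xi : G -> cplx R) (u : G) (P : set G).

Definition supp' f : set G := [set x | f x != 0].

Definition Cc f := continuous f /\ compact (closure (supp' f)).

(* C_c(P), extended by zero, for P open. *)
Definition Cc_on P f := Cc f /\ closure (supp' f) `<=` P.

(* Ind_u(f) and conv are finite sums when f is in C_c(G): an etale fibre meets
   a compact set in a finite set. *)
Definition Ind u f xi : G -> cplx R :=
  fun x => \sum_(y \in fiber u) f (gmul x (ginv y)) * xi y.

Definition conv f g : G -> cplx R :=
  fun x => \sum_(y \in fiber (src x)) f (gmul x (ginv y)) * g y.

Definition involution f : G -> cplx R := fun x => Num.conj (f (ginv x)).

(* The norm of the restriction of xi to G_u, +oo if it is not in l^2(G_u). *)
Definition l2norm u xi : \bar R :=
  sqrte (esum (fiber u) (fun x => (modulus (xi x) ^+ 2)%:E)).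

Definition op_norm u f : \bar R :=
  ereal_sup [set l2norm u (Ind u f xi) |
             xi in [set xi | (l2norm u xi <= 1%:E)%E]].

(* The supremum is taken in [0, +oo]: 0 matters only when G is empty. *)
Definition red_norm f : \bar R :=
  maxe 0%E (ereal_sup [set op_norm u f | u in units G]).

End Functions.

Record cstarAlg (R : realType) := CstarAlg {
  cs_space :> completeNormedModType (cplx R);
  cs_mul : cs_space -> cs_space -> cs_space;
  cs_star : cs_space -> cs_space;
  cs_mulA : associative cs_mul;
  cs_mulDl : left_distributive cs_mul +%R;
  cs_mulDr : right_distributive cs_mul +%R;
  cs_scaleAl : forall (c : cplx R) a b, cs_mul (c *: a) b = c *: cs_mul a b;
  cs_scaleAr : forall (c : cplx R) a b, cs_mul a (c *: b) = c *: cs_mul a b;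
  cs_starK : involutive cs_star;
  cs_starD : {morph cs_star : a b / a + b};
  cs_starZ : forall (c : cplx R) a, cs_star (c *: a) = Num.conj c *: cs_star a;
  cs_starM : forall a b, cs_star (cs_mul a b) = cs_mul (cs_star b) (cs_star a);
  cs_normM : forall a b, `|cs_mul a b| <= `|a| * `|b|;
  cs_normC : forall a, `|cs_mul (cs_star a) a| = `|a| ^+ 2
}.

(* C_r^*(G) is determined, up to a unique isomorphism over C_c(G), as a
   C*-algebra with an isometric *-homomorphism of dense range from C_c(G)
   with the reduced norm. The values of the embedding outside C_c(G) are
   unconstrained and never used. *)
Record reducedCstar (R : realType) (G : etaleGroupoid) := ReducedCstar {
  rc_alg :> cstarAlg R;
  rc_emb : (G -> cplx R) -> rc_alg;
  rc_embD : forall f g, Cc f -> Cc g ->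
    rc_emb (fun x => f x + g x) = rc_emb f + rc_emb g;
  rc_embZ : forall c f, Cc f -> rc_emb (fun x => c * f x) = c *: rc_emb f;
  rc_embM : forall f g, Cc f -> Cc g ->
    rc_emb (conv f g) = cs_mul (rc_emb f) (rc_emb g);
  rc_emb_star : forall f, Cc f -> rc_emb (involution f) = cs_star (rc_emb f);
  rc_emb_norm : forall f, Cc f -> (rnorm (rc_emb f))%:E = red_norm f;
  rc_emb_dense : dense [set rc_emb f | f in [set f | Cc f]]
}.

Section ReducedCstar.
Variables (R : realType) (G : etaleGroupoid) (A : reducedCstar R G).
Implicit Types (a b : A) (M I J : set A) (P U : set G).

(* j(a): the extension by continuity of the inclusion of C_c(G) in C_0(G),
   that is, the limit of f as f in C_c(G) tends to a in norm. *)
Definition j a : G -> cplx R := fun x =>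
  lim (f x @[f --> filter_from (nbhs a)
                     (fun N => [set f | Cc f /\ N (rc_emb A f)])]).

Definition Cc_closure P : set A :=
  closure [set rc_emb A f | f in [set f | Cc_on P f]].

(* On C_c(G^(0)) the reduced norm is the supremum norm, so this closure is the
   copy of C_0(G^(0)) in C_r^*(G). *)
Definition C0_units : set A := Cc_closure (units G).

Definition closed_subspace M :=
  [/\ closed M, M 0 & forall (c : cplx R) a b, M a -> M b -> M (c *: a + b)].

Definition diagonal_bimodule M :=
  closed_subspace M /\
  forall a b, M a -> C0_units b -> M (cs_mul a b) /\ M (cs_mul b a).

Definition closed_ideal I :=
  closed_subspace I /\
  forall a b, I a -> I (cs_mul a b) /\ I (cs_mul b a).

Definition spectrum M : set G := [set x | exists2 a, M a & j a x != 0].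

Definition vanishing_off P : set A := [set a | forall x, ~ P x -> j a x = 0].

Definition spectral M :=
  diagonal_bimodule M /\ M = vanishing_off (spectrum M).

Definition fourier_approximation :=
  forall a, Cc_closure (supp' (j a)) a.

Definition dynamical_ideal I :=
  closed_ideal I /\
  exists U : set G, [/\ rel_open (units G) U, invariant U &
                        I = Cc_closure (reduction U)].

End ReducedCstar.

Arguments vanishing_off {R G} A P.

(* Main.v *)
Require Import Defs.
From HB Require Import structures.
From mathcomp Require Import all_boot all_order all_algebra.
From mathcomp Require Import complex.
From mathcomp Require Import all_classical all_reals all_analysis.
Import Order.TTheory GRing.Theory Num.Theory.
Import numFieldNormedType.Exports.
Local Open Scope classical_set_scope.
Local Open Scope ring_scope.

(** Write a(x) for the value at the arrow x of the function j(a) attached to an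
    element a of the reduced algebra.  The whole argument is about the zero sets
    of these functions, and it rests on one computation: if f is a compactly
    supported function living on a slice W (an open set on which the range map
    is injective), then the convolution sum for f a has a single term,

      (f a)(x) = f(y) a(y^-1 x),   y being the point of W with r(y) = r(x),

    and (f a)(x) = 0 when there is no such y ([j_slice_mul], [j_slice_mul0]).

    Two consequences are read off from this formula.  Taking f(y) = 1 by
    Urysohn's lemma ([bump]), a nonzero value of an element of an ideal I can be
    transported by left multiplication in the groupoid, so the spectrum of I
    absorbs multiplication; the adjoint exchanges left and right
    ([spectrum_mul_invariant]).  Conversely, if H absorbs multiplication, then
    f a vanishes off H as soon as a does; since every function in C_c is a sum
    of functions living on slices ([Cc_slice_ind], a partition of unity) and
    these are dense, A(H) is an ideal ([vanishing_off_closed_ideal]).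

    The approximation property says exactly what is needed to identify A(H)
    with the closure of C_c(H) ([Cc_closureE]).  An open set H that absorbs
    multiplication is the reduction of G to its units H `&` units, and the
    reduction to an open invariant set absorbs multiplication; hence the
    dynamical ideals are exactly the A(H) for such H ([dynamical_idealP]).
    Finally the spectrum recovers an open set H from A(H)
    ([spectrum_vanishing_off]).  Since I -> spectrum I and H -> A(H) are
    monotone and I is contained in A(spectrum I), minimality, the criterion for
    spectrality and the bijection are formal. *)

Set Implicit Arguments.
Unset Strict Implicit.
Unset Printing Implicit Defensive.

(** * Continuity and separation *)

Lemma lipschitz_continuous_normed (K : numFieldType) (V W : normedModType K)
    (F : V -> W) (k : K) :
  0 <= k -> (forall x y, `|F x - F y| <= k * `|x - y|) -> continuous F.
Proof.
move=> k0 Fk x; apply/cvgrPdist_le => e e0.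
have k1 : 0 < k + 1 by rewrite ltr_wpDl.
near=> y; apply: le_trans (Fk _ _) _.
apply: (@le_trans _ _ ((k + 1) * (e / (k + 1)))); last first.
  by rewrite mulrCA mulfV ?mulr1// gt_eqF.
apply: ler_pM => //; first by rewrite lerDl.
by near: y; apply: cvgr_dist_le => //; rewrite divr_gt0.
Unshelve. all: by end_near. Qed.

Lemma continuous_eq_closed (T : topologicalType) (S : topologicalType)
    (f g : T -> S) : hausdorff_space S -> continuous f -> continuous g ->
  closed [set x | f x = g x].
Proof.
move=> hS fc gc x clx; apply: hS => U V Ux Vx.
have Ufx : nbhs x (f @^-1` U) by exact: fc.
have Vgx : nbhs x (g @^-1` V) by exact: gc.
have [y [/= fgy [Uy Vy]]] := clx _ (filterI Ufx Vgx).
by exists (f y); split => //; rewrite fgy.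
Qed.

(** Urysohn's lemma for a point of a locally compact space only separates it
    from a closed set; to get compact support inside W, the separating function
    is cut off at height 1/2, so that the support stays in its sublevel set. *)
Lemma urysohn_bump (R : realType) (X : topologicalType) (W : set X) (x : X) :
  locally_compact [set: X] -> hausdorff_space X -> open W -> W x ->
  exists phi : X -> R, [/\ continuous phi, forall y, 0 <= phi y, phi x = 1,
    compact (closure [set y | phi y != 0]) &
    closure [set y | phi y != 0] `<=` W].
Proof.
move=> lcX hX oW Wx; have [N] := lcX x I; rewrite withinET => Nx [cN clN].
pose V := N° `&` W.
have oV : open V by apply: openI => //; exact: open_interior.
have nVx : ~ (~` V) x by apply; split.
have := @locally_compact_completely_regular X R lcX hX x _ (open_closedC oV).
move=> /(_ nVx) /uniform_separatorP => /(_ R)[f [fc _ fx fV]].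
have {}fx : f x = 0 by apply: fx; exists x.
pose psi y := 1 - f y *+ 2.
have psic : continuous psi.
  by move=> y; apply: cvgB; [exact: cvg_cst | apply: cvgMn; exact: fc].
pose phi y := Num.max 0 (psi y).
have phi_supp : closure [set y | phi y != 0] `<=` [set y | 0 <= psi y].
  move=> y; apply: contraPP => /negP; rewrite -ltNge => psiy cly.
  have [z [/= + psiz]] := cly _ (psic y _ (lt_nbhsl psiy)).
  by rewrite /phi max_l ?eqxx// ltW.
have suppV : closure [set y | phi y != 0] `<=` V.
  apply: (subset_trans phi_supp) => y /= psiy; apply: contrapT => Vy.
  have fy : f y = 1 by apply: fV; exists y.
  by move: psiy; rewrite /psi fy mulr2n opprD addrA subrr add0r oppr_ge0 ler10.
exists phi; split.
- move=> y; apply: (@continuous_max R X (cst 0) psi y); first exact: cvg_cst.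
  exact: psic.
- by move=> y; rewrite le_max lexx.
- by rewrite /phi /psi fx mul0rn subr0 max_r.
- apply: (subclosed_compact _ cN); first exact: closed_closure.
  by move=> y /suppV[/interior_subset].
- by move=> y /suppV[].
Qed.

(** Follows from the near-covering form of compactness, applied along the
    filter generated by the sets of all finite families extending a given
    one. *)
Lemma compact_finite_subcover (T : topologicalType) (I : eqType) (K : set T)
    (U : I -> set T) : compact K -> (forall i, open (U i)) ->
  (forall x, K x -> exists i, U i x) ->
  exists s : seq I, forall x, K x -> exists2 i, i \in s & U i x.
Proof.
move=> /compact_near_coveringP cK oU KU.
pose F :=
  filter_from setT (fun s0 : seq I => [set s : seq I | {subset s0 <= s}]).
have FF : Filter F.
  apply: filter_from_filter; first by exists [::].
  move=> s t _ _; exists (s ++ t) => // r str.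
  by split=> i ir; apply: str; rewrite mem_cat ir ?orbT.
have [x Kx|s _ sK] := cK _ F (fun s x => exists2 i, i \in s & U i x) FF.
  have [i Uix] := KU x Kx; exists (U i, [set s : seq I | i \in s]) => /=.
    split; first by apply: open_nbhs_nbhs; split.
    by exists [:: i] => // s; apply; rewrite inE.
  by move=> [y s] [/= Uiy si]; exists i.
by exists s; exact: sK.
Qed.

Section ComplexNumbers.
Variable R : realType.
Local Notation C := (cplx R).

Lemma normC_real_complex (t : R) : `|(t%:C)%C : C| = (`|t|%:C)%C.
Proof. by rewrite /cplx normc_def /= expr0n /= addr0 sqrtr_sqr. Qed.

Lemma gt0_real_complex (e : C) :
  0 < e -> e = ((complex.Re e)%:C)%C /\ 0 < complex.Re e.
Proof. by case: e => a b; rewrite /cplx ltcE /= => /andP[/eqP-> ?]. Qed.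

Lemma normC_le_Re_Im (z : C) :
  `|z| <= ((`|complex.Re z| + `|complex.Im z|)%:C)%C.
Proof.
rewrite rmorphD /= -!normC_real_complex {1}(complexE z).
apply: le_trans (ler_normD _ _) _; rewrite lerD2l normrM.
by rewrite /cplx normc_def /= expr0n /= add0r expr1n sqrtr1 mul1r.
Qed.

Lemma real_complex_continuous : continuous (fun t : R => (t%:C)%C : C).
Proof.
move=> t; apply/cvgrPdist_le => e /gt0_real_complex[-> e0].
near=> s; rewrite -rmorphB normC_real_complex /cplx lecR.
by near: s; apply: cvgr_dist_le.
Unshelve. all: by end_near. Qed.

(** Reduces completeness of the complex numbers to that of the reals: both
    coordinates of a Cauchy filter are Cauchy. *)
Lemma complex_cauchy_cvg (F : set_system C) :
  ProperFilter F -> (forall e : C, 0 < e -> exists z : C, F (ball z e)) ->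
  exists z : C, F --> z.
Proof.
move=> FF Fc.
have small (p : C -> R) : (forall z w : C, (`|p z - p w|%:C)%C <= `|z - w|) ->
    cvg (p @ F).
  move=> pL; apply/cauchy_cvgP; apply: cauchy_exP => e e0.
  have [|z Fz] := Fc (e%:C)%C; first by rewrite /cplx ltcR.
  exists (p z); rewrite /nbhs /=; apply: filterS Fz => w zw /=.
  rewrite /ball /=.
  by have := le_lt_trans (pL z w) zw; rewrite /cplx ltcR.
have /cvg_ex[a Fa] : cvg (@complex.Re R @ F).
  by apply: small => z w; rewrite -raddfB; exact: normc_ge_Re.
have /cvg_ex[b Fb] : cvg (@complex.Im R @ F).
  apply: small => z w; rewrite -raddfB /=.
  have := normc_ge_Re ((z - w) * 'i%C); rewrite ReiNIm normrN normrM.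
  by rewrite [`|'i%C|]normc_def /= expr0n /= add0r expr1n sqrtr1 mulr1.
exists (Complex a b); apply/cvgrPdist_le => e /gt0_real_complex[-> e0].
have e20 : 0 < complex.Re e / 2 by rewrite divr_gt0.
near=> w; apply: le_trans (normC_le_Re_Im _) _.
rewrite /cplx lecR (splitr (complex.Re e)) !raddfB /=; apply: lerD.
  by near: w; move/cvgrPdist_le: Fa; apply.
by near: w; move/cvgrPdist_le: Fb; apply.
Unshelve. all: by end_near. Qed.

Lemma conjC_continuous : continuous (@Num.conj C).
Proof.
apply: (@lipschitz_continuous_normed C C C _ 1) => // z w.
by rewrite mul1r -rmorphB norm_conjC.
Qed.

End ComplexNumbers.

(** * Groupoids and slices *)

Section GroupoidAlgebra.
Variable G : groupoid.
Implicit Types g h x : G.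

Lemma ginv_src g : ginv (src g) = src g.
Proof. by rewrite -[LHS]gmul_unitl rng_inv src_src gmulV rng_src. Qed.

Lemma gmulKr g h : src g = rng h -> gmul (gmul g h) (ginv h) = g.
Proof. by move=> gh; rewrite -gmulA ?rng_inv// gmulV -gh gmul_unitr. Qed.

Lemma gmulVKr g h : src g = src h -> gmul (gmul g (ginv h)) h = g.
Proof.
by move=> gh; rewrite -gmulA ?rng_inv ?src_inv// gmulVg -gh gmul_unitr.
Qed.

Lemma gmulKl g h : src g = rng h -> gmul (ginv g) (gmul g h) = h.
Proof. by move=> gh; rewrite gmulA ?src_inv// gmulVg gh gmul_unitl. Qed.

Lemma gmulVKl g h : rng g = rng h -> gmul g (gmul (ginv g) h) = h.
Proof. by move=> gh; rewrite gmulA ?src_inv ?rng_inv// gmulV gh gmul_unitl. Qed.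

Lemma ginvK : involutive (@ginv G).
Proof.
move=> g; have := @gmulKl (ginv g) g (src_inv g).
by rewrite gmulVg -rng_inv -src_inv gmul_unitr.
Qed.

Lemma ginvM g h : src g = rng h -> ginv (gmul g h) = gmul (ginv h) (ginv g).
Proof.
move=> gh; have hg : src (ginv h) = rng (ginv g) by rewrite src_inv rng_inv.
have e : gmul (gmul g h) (gmul (ginv h) (ginv g)) = rng g.
  by rewrite gmulA ?gmulKr ?gmulV// src_mul// rng_inv.
rewrite -[RHS](@gmulKl (gmul g h)); last by rewrite src_mul// rng_mul// rng_inv.
by rewrite e -(rng_mul gh) -src_inv gmul_unitr.
Qed.

End GroupoidAlgebra.

Section EtaleTopology.
Variable G : etaleGroupoid.
Implicit Types (x y : G) (V W : set G).

Lemma local_homeo_continuous (T : topologicalType) (Y : set T) (f : T -> T) :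
  local_homeo Y f -> continuous f.
Proof.
move=> [_ lf] x; have [U [oU Ux _ fU _]] := lf x.
have := continuous_open_subspace f oU; rewrite propeqE => -[/(_ fU) fc _].
by apply: fc; rewrite inE.
Qed.

Lemma rng_continuous : continuous (@rng G).
Proof. exact: local_homeo_continuous (eg_rng_local_homeo G). Qed.

Lemma src_continuous : continuous (@src G).
Proof. exact: local_homeo_continuous (eg_src_local_homeo G). Qed.

Lemma ginv_continuous : continuous (@ginv G).
Proof. by have [] := eg_topological G. Qed.

(** Source and range are continuous into the groupoid with values among the
    units, so preimages see only the trace of an open set on the units. *)
Lemma rel_open_preimage (U : set G) (p : G -> G) :
  continuous p -> (forall x, units G (p x)) -> rel_open (units G) U ->
  open (p @^-1` U).
Proof.
move=> pc pu [W oW ->].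
rewrite [X in open X](_ : _ = p @^-1` W); first by move/continuousP: pc; apply.
by apply/seteqP; split => [x []//|x Wx]; split.
Qed.

Lemma units_src x : units G (src x). Proof. by exists x. Qed.
Lemma units_rng x : units G (rng x).
Proof. by exists (rng x) => //; rewrite src_rng. Qed.

(** The third clause makes the local section of the range map given by a slice
    continuous. *)
Definition rslice (W : set G) := [/\ open W, set_inj W (@rng G) &
  forall V, open V -> V `<=` W -> rel_open (units G) (@rng G @` V)].

Lemma rslice_ex x : exists2 W, rslice W & W x.
Proof. by have [_ /(_ x)[U [? ? ? _ ?]]] := eg_rng_local_homeo G; exists U. Qed.

(** The range map is open on a slice, so the arrows whose range is attained in
    V form an open set. *)
Lemma open_rng_saturation W V : rslice W -> open V -> V `<=` W ->
  open [set x | exists2 y, V y & rng y = rng x].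
Proof.
move=> [_ _ h] oV VW.
exact: (rel_open_preimage rng_continuous units_rng (h _ oV VW)).
Qed.

(** Multiplication is continuous only on composable pairs, so a limit of
    products needs composability along the filter. *)
Lemma gmul_cvg (T : Type) (F : set_system T) (p q : T -> G) x y : Filter F ->
  (\forall t \near F, src (p t) = rng (q t)) -> src x = rng y ->
  p @ F --> x -> q @ F --> y -> (fun t => gmul (p t) (q t)) @ F --> gmul x y.
Proof.
move=> FF pq xy px qy; have [mc _] := eg_topological G.
move/subspace_continuousP: mc => /(_ (x, y) xy) mc U Uxy.
have := mc U Uxy; rewrite /within /= => -[[A B] [/= Ax By] AB].
apply: filterS3 pq (px A Ax) (qy B By) => t pqt /= At Bt.
exact: (AB (p t, q t)).
Qed.

Lemma closed_composable : closed (@composable G).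
Proof.
apply: continuous_eq_closed; first exact: eg_hausdorff.
- by move=> p; apply: continuous_comp; [exact: cvg_fst | exact: src_continuous].
- by move=> p; apply: continuous_comp; [exact: cvg_snd | exact: rng_continuous].
Qed.

Lemma compact_gprod (K L : set G) : compact K -> compact L ->
  compact (gprod K L).
Proof.
move=> cK cL; rewrite (_ : gprod K L =
  (fun p : G * G => gmul p.1 p.2) @` (@composable G `&` K `*` L)); last first.
  apply/seteqP; split=> x [] => [a [b [Ka Lb ab ->]]|[a b] /= [ab [Ka Lb]] <-].
    by exists (a, b).
  by exists a, b.
apply: continuous_compact.
  by apply: continuous_subspaceW (proj1 (eg_topological G)) => ? [].
rewrite setIC; apply: compact_closedI; first exact: compact_setX.
exact: closed_composable.
Qed.

End EtaleTopology.

(** * Convolution with functions supported on slices *)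

Section CompactlySupported.
Variables (R : realType) (G : etaleGroupoid).
Local Notation C := (cplx R).
Implicit Types (f g : G -> C) (K W : set G) (x y : G).

Lemma closure_supp_sub f K : compact K -> supp' f `<=` K ->
  closure (supp' f) `<=` K.
Proof.
move=> cK fK; rewrite (closure_id K).1; first exact: closureS.
exact: (compact_closed (@eg_hausdorff G) cK).
Qed.

Lemma Cc_supported f K : continuous f -> compact K -> supp' f `<=` K -> Cc f.
Proof.
move=> fc cK fK; split => //; apply: (subclosed_compact _ cK).
  exact: closed_closure.
exact: closure_supp_sub.
Qed.

Lemma supp_closure f x : f x != 0 -> closure (supp' f) x.
Proof. by move=> fx; apply: subset_closure. Qed.

Lemma off_supp0 f K x : supp' f `<=` K -> ~ K x -> f x = 0.
Proof. by move=> fK Kx; apply/eqP; apply: contrapT => /negP /fK. Qed.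

Lemma open_supp f : continuous f -> open (supp' f).
Proof.
move=> fc; rewrite (_ : supp' f = ~` [set x | f x = 0]).
  apply: closed_openC; apply: continuous_eq_closed => //.
  by move=> x; exact: cvg_cst.
by apply/seteqP; split => x /eqP.
Qed.

Lemma Cc0 : Cc (fun _ : G => 0 : C).
Proof.
apply: (Cc_supported _ compact0); first by move=> x; exact: cvg_cst.
by move=> x; rewrite /supp' /= eqxx.
Qed.

Lemma CcD f g : Cc f -> Cc g -> Cc (fun x => f x + g x).
Proof.
move=> [fc fK] [gc gK]; apply: (Cc_supported _ (compactU fK gK)).
  by move=> x; apply: cvgD; [exact: fc | exact: gc].
move=> x; rewrite /supp' /= => fgx.
have [fx0|fx] := eqVneq (f x) 0; last by left; exact: supp_closure.
by right; apply: supp_closure; move: fgx; rewrite fx0 add0r.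
Qed.

Lemma CcZ c f : Cc f -> Cc (fun x => c * f x).
Proof.
move=> [fc fK]; apply: (Cc_supported _ fK).
  by move=> x; apply: cvgM; [exact: cvg_cst | exact: fc].
move=> x; rewrite /supp' /= mulf_eq0 negb_or => /andP[_].
exact: supp_closure.
Qed.

Lemma Cc_involution f : Cc f -> Cc (involution f).
Proof.
move=> [fc fK].
have cK : compact (@ginv G @` closure (supp' f)).
  apply: continuous_compact fK; apply: continuous_subspaceT.
  exact: ginv_continuous.
apply: (Cc_supported _ cK).
  move=> x; apply: continuous_comp; last exact: conjC_continuous.
  by apply: continuous_comp; [exact: ginv_continuous | exact: fc].
move=> x; rewrite /supp' /= /involution conjC_eq0 => fx.
by exists (ginv x); [exact: supp_closure | rewrite ginvK].
Qed.

Lemma bump W x : open W -> W x ->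
  exists phi : G -> C, [/\ Cc_on W phi, forall y, 0 <= phi y & phi x = 1].
Proof.
move=> oW Wx; have [phi [pc p0 px pK pW]] :=
  @urysohn_bump R _ _ _ (@eg_locally_compact G) (@eg_hausdorff G) oW Wx.
have suppE : supp' (fun y => (phi y)%:C%C : C) = [set y | phi y != 0].
  apply/seteqP; split => y; rewrite /supp' /=.
    by apply: contra => /eqP ->; rewrite rmorph0.
  apply: contra; rewrite /cplx -(rmorph0 (real_complex R)) => /eqP.
  by move=> /complexI ->.
exists (fun y => (phi y)%:C%C : C); split.
- split; last by rewrite suppE.
  split; last by rewrite suppE.
  by move=> y; apply: continuous_comp;
    [exact: pc | exact: real_complex_continuous].
- by move=> y; rewrite /cplx ler0c.
- by rewrite px rmorph1.
Qed.

Lemma conv_supp f g : supp' (Defs.conv f g) `<=` gprod (supp' f) (supp' g).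
Proof.
move=> x; rewrite /supp' /= => /eqP nz; apply: contrapT => nK.
apply: nz; apply: fsbig1 => y /= yx; apply/eqP; rewrite mulf_eq0.
apply: contrapT => /negP; rewrite negb_or => /andP[fx gy]; apply: nK.
exists (gmul x (ginv y)), y; split => //.
- by rewrite src_mul ?rng_inv// src_inv.
- by rewrite gmulVKr.
Qed.

(** The nonzero terms of the sum have x z^-1 in W with the range of x, and y
    is the only such arrow; so only z = y^-1 x contributes. *)
Lemma conv_slice f g W x y : set_inj W (@rng G) -> supp' f `<=` W -> W y ->
  rng y = rng x -> Defs.conv f g x = f y * g (gmul (ginv y) x).
Proof.
move=> injW fW Wy yx; have y'x : src (ginv y) = rng x by rewrite src_inv.
have sz : src (gmul (ginv y) x) = src x by rewrite src_mul.
transitivity (\sum_(z \in [set gmul (ginv y) x]) f (gmul x (ginv z)) * g z).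
  apply/esym/fsbig_widen => [_ -> //|z [/= zx zy]].
  apply/eqP; rewrite mulf_eq0; apply/orP; left; apply/eqP.
  apply: (off_supp0 fW) => Wz; apply: zy.
  have e : gmul x (ginv z) = y.
    by apply: injW; rewrite ?inE// rng_mul ?rng_inv.
  by rewrite -e ginvM ?rng_inv// ginvK gmulVKr// -?zx// ?src_inv.
rewrite fsbig_set1; congr (f _ * _).
by rewrite ginvM// ginvK gmulVKl.
Qed.

(** Near a point x whose range is hit by the support of f, the product is
    z |-> f(s z) g((s z)^-1 z), where s z is the arrow of W with the range of z;
    this s is continuous because the range map is injective and open on W. *)
Lemma Cc_conv_slice W f g : rslice W -> Cc_on W f -> Cc g ->
  Cc (Defs.conv f g).
Proof.
move=> sW [[fc fK] fW] [gc gK]; have [oW injW _] := sW.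
have fW' : supp' f `<=` W := subset_trans (@subset_closure _ _) fW.
apply: (Cc_supported _ (compact_gprod fK gK)); last first.
  apply: subset_trans (@conv_supp f g) _ => x [a [b [fa gb ab ->]]].
  by exists a, b; split => //; exact: subset_closure.
move=> x; have [[y Ky yx]|nx] :=
    pselect (exists2 y, closure (supp' f) y & rng y = rng x); last first.
  (* Off the range of the support, the product vanishes. *)
  have clK : closed (@rng G @` closure (supp' f)).
    apply: (compact_closed (@eg_hausdorff G)); apply: continuous_compact fK.
    by apply: continuous_subspaceT; exact: rng_continuous.
  have oN : open (@rng G @^-1` ~` (@rng G @` closure (supp' f))).
    by move/continuousP: (@rng_continuous G); apply; exact: closed_openC.
  have conv0 z : ~ (@rng G @` closure (supp' f)) (rng z) ->
      Defs.conv f g z = 0.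
    move=> nz; apply/eqP; apply: contrapT.
    move=> /negP/conv_supp[a [b [fa _ ab zE]]].
    by apply: nz; exists a; [exact: subset_closure | rewrite zE rng_mul].
  have nx' : ~ (@rng G @` closure (supp' f)) (rng x).
    by move=> [y Ky yx]; apply: nx; exists y.
  rewrite /continuous_at conv0//.
  apply: (@cvg_trans _ ((fun=> 0 : C) @ nbhs x)); last exact: cvg_cst.
  apply: near_eq_cvg.
  have : nbhs x (@rng G @^-1` ~` (@rng G @` closure (supp' f))).
    by apply: open_nbhs_nbhs; split.
  by apply: filterS => z nz; rewrite conv0.
(* Over it, the product is given by the local section s of the range map. *)
have Wy := fW _ Ky.
pose N (V : set G) : set G := [set z | exists2 a, V a & rng a = rng z].
have NV V : open V -> V `<=` W -> V y -> nbhs x (N V).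
  by move=> oV VW Vy; apply: open_nbhs_nbhs; split;
    [exact: (open_rng_saturation sW oV VW) | exists y].
pose s z := xget y [set a | W a /\ rng a = rng z].
have sP z : N W z -> W (s z) /\ rng (s z) = rng z.
  move=> [a Wa az]; apply: (@xgetPex _ y [set a | W a /\ rng a = rng z]).
  by exists a.
have s_unique a z : W a -> rng a = rng z -> s z = a.
  move=> Wa az; have [|Ws sz] := sP z; first by exists a.
  by apply: injW; rewrite ?inE// sz.
have sc : s z @[z --> x] --> y.
  move=> V; rewrite nbhsE => -[V' [oV' V'y] V'V].
  have := @NV (V' `&` W) (openI oV' oW) (@subIsetr _ _ _) (conj V'y Wy).
  apply: filterS => z [a [V'a Wa] az] /=.
  by rewrite (s_unique _ _ Wa az); exact: V'V.
rewrite /continuous_at (conv_slice g injW fW' Wy yx).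
apply: (@cvg_trans _ ((fun z => f (s z) * g (gmul (ginv (s z)) z)) @ nbhs x)).
  apply: near_eq_cvg; have := NV W oW (@subset_refl _ _) Wy.
  apply: filterS => z /sP[Wsz sz].
  by rewrite -(conv_slice g injW fW' Wsz sz).
apply: cvgM; first by apply: (cvg_comp s f sc); exact: fc.
apply: (@cvg_comp _ _ _ (fun z => gmul (ginv (s z)) z) g); last exact: gc.
apply: gmul_cvg => //; last 1 first.
- by apply: (cvg_comp s (@ginv G) sc); exact: ginv_continuous.
- have := NV W oW (@subset_refl _ _) Wy; apply: filterS => z /sP[_ sz].
  by rewrite src_inv.
- by rewrite src_inv.
Qed.

End CompactlySupported.

Section SliceDecomposition.
Variables (R : realType) (G : etaleGroupoid).
Local Notation C := (cplx R).
Implicit Types (f g s : G -> C) (K W : set G) (x y : G).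

(** The quotient by s is harmless: f vanishes near every point where s may be
    zero, because s has no zero on the closed support of f. *)
Lemma Cc_on_quotient f g s W : Cc f -> Cc_on W g -> continuous s ->
  (forall x, closure (supp' f) x -> s x != 0) ->
  Cc_on W (fun x => f x * (g x / s x)).
Proof.
move=> [fc fK] [[gc gK] gW] sc s0; set h := fun x => _.
have hg : supp' h `<=` closure (supp' g).
  move=> x; rewrite /supp' /= /h !mulf_eq0 !negb_or => /and3P[_ gx _].
  exact: supp_closure.
split; last exact: subset_trans (closure_supp_sub gK hg) gW.
apply: (Cc_supported _ gK hg) => x.
have [Kx|nKx] := pselect (closure (supp' f) x).
  apply: cvgM; [exact: fc | apply: cvgM; first exact: gc].
  by apply: cvgV; [exact: s0 | exact: sc].
have h0 z : ~ closure (supp' f) z -> h z = 0.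
  by move=> nz; rewrite /h (off_supp0 (@subset_closure _ _) nz) mul0r.
rewrite /continuous_at h0//.
apply: (@cvg_trans _ ((fun=> 0 : C) @ nbhs x)); last exact: cvg_cst.
apply: near_eq_cvg.
have : nbhs x (~` closure (supp' f)).
  by apply: open_nbhs_nbhs; split => //; exact/closed_openC/closed_closure.
by apply: filterS => z /h0.
Qed.

(** Partition of unity: bump functions phi_i on slices, finitely many of which
    have no common zero on the support of f, have a sum s, and f is the sum of
    the functions f phi_i / s. *)
Lemma Cc_slice_ind (P : (G -> C) -> Prop) :
  P (fun=> 0) ->
  (forall f g, Cc f -> Cc g -> P f -> P g -> P (fun x => f x + g x)) ->
  (forall W f, rslice W -> Cc_on W f -> P f) ->
  forall f, Cc f -> P f.
Proof.
move=> P0 PD Ps f fCc; have [fc fK] := fCc.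
have /choice[phi phiP] : forall x, exists phi : G -> C,
    [/\ exists2 W, rslice W & Cc_on W phi, forall y, 0 <= phi y & phi x = 1].
  move=> x; have [W sW Wx] := rslice_ex x; have [oW _ _] := sW.
  have [phi [? ? ?]] := @bump R G W x oW Wx.
  by exists phi; split => //; exists W.
have phic i : continuous (phi i) by have [[W _ [[]]]] := phiP i.
have oD i : open [set y | phi i y != 0].
  exact: open_supp (phic i).
have [|D fD] := compact_finite_subcover fK oD.
  by move=> x _; exists x => /=; have [_ _ ->] := phiP x; exact: oner_neq0.
pose s x := \sum_(i <- D) phi i x.
have sc : continuous s.
  rewrite /s; elim: (D) => [|i r IH].
    by under eq_fun do rewrite big_nil; move=> x; exact: cvg_cst.
  under eq_fun do rewrite big_cons.
  by move=> x; apply: cvgD; [exact: phic | exact: IH].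
have s0 x : closure (supp' f) x -> s x != 0.
  move=> /fD[i iD ix]; rewrite /s psumr_neq0; last first.
    by move=> k _; have [_ + _] := phiP k; apply.
  apply/hasP; exists i => //; rewrite lt_def ix /=.
  by have [_ + _] := phiP i; apply.
pose q i x := f x * (phi i x / s x).
have qP i : exists2 W, rslice W & Cc_on W (q i).
  have [[W sW Wi] _ _] := phiP i.
  by exists W; last exact: (Cc_on_quotient fCc Wi sc s0).
pose sq (r : seq G) x := \sum_(i <- r) q i x.
have sq_nil : sq [::] = fun=> 0 by apply/funext => x; rewrite /sq big_nil.
have sq_cons i r : sq (i :: r) = fun x => q i x + sq r x.
  by apply/funext => x; rewrite /sq big_cons.
have sqP r : Cc (sq r) /\ P (sq r).
  elim: r => [|i r [IC IP]].
    by rewrite sq_nil; split; [exact: Cc0 | exact: P0].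
  have [W sW qW] := qP i; have [qC _] := qW; rewrite sq_cons.
  by split; [exact: CcD | exact: (PD _ _ qC IC (Ps _ _ sW qW) IP)].
have [_] := sqP D; congr P; apply/funext => x; rewrite /sq /q.
rewrite -mulr_sumr -mulr_suml -/(s x).
have [Kx|nKx] := pselect (closure (supp' f) x).
  by rewrite divff ?mulr1// s0.
by rewrite (off_supp0 (@subset_closure _ _) nKx) mul0r.
Qed.

End SliceDecomposition.

(** * Evaluation at an arrow *)

Section Evaluation.
Variables (R : realType) (G : etaleGroupoid) (A : reducedCstar R G).
Local Notation C := (cplx R).
Implicit Types (f g : G -> C) (x y : G) (a b : A).
Local Notation emb := (rc_emb A).

Lemma normr_rnorm (V : normedModType C) (v : V) : `|v| = ((rnorm v)%:C)%C.
Proof.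
have : 0 <= `|v| :> C by [].
by rewrite /rnorm; case: `|v| => p q; rewrite /cplx lecE /= => /andP[/eqP -> _].
Qed.

(** Let u be the source of x and d the point mass at u, a unit vector: then
    Ind_u(f) d is the restriction of f to the fibre of u, whose norm is at
    least the modulus of its coordinate f(x). *)
Lemma modulus_le_red_norm f x : ((modulus (f x))%:E <= red_norm f)%E.
Proof.
pose u := src x; pose d y : C := (y == u)%:R.
have m0 (z : C) : 0 <= modulus z.
  by rewrite /modulus /cplx normc_def /= sqrtr_ge0.
have Ed y : fiber u y -> Ind u f d y = f y.
  move=> yu; rewrite /Ind.
  transitivity (\sum_(z \in [set u]) f (gmul y (ginv z)) * d z).
    apply/esym/fsbig_widen => [_ -> |z [/= _ /eqP zu]]; first exact: src_src.
    by rewrite /d (negbTE zu) mulr0.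
  by rewrite fsbig_set1 /d eqxx mulr1 ginv_src -[src x]yu gmul_unitr.
have d1 : (l2norm u d <= 1%:E)%E.
  rewrite /l2norm (esumID [set u]); last by move=> y _; rewrite lee_fin sqr_ge0.
  rewrite (_ : fiber u `&` [set u] = [set u]); last first.
    by apply/setIidPr => _ ->; exact: src_src.
  rewrite esum_set1 ?lee_fin ?sqr_ge0// esum1; last first.
    by move=> y [_ /eqP yu]; rewrite /d (negbTE yu) /modulus normr0 expr0n.
  by rewrite adde0 /d eqxx /modulus normr1 /= expr1n /sqrte sqrtr1.
have fx : ((modulus (f x))%:E <= l2norm u (Ind u f d))%E.
  rewrite -[X in (X <= _)%E]gee0_abs ?lee_fin// -sqrte_sqr /l2norm.
  rewrite lee_sqrt; last by apply: esum_ge0 => y _; rewrite lee_fin sqr_ge0.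
  apply: esum_ge; exists [set x].
    by split; [exact: finite_set1|move=> _ ->].
  by rewrite fsbig_set1 Ed// EFin_expe.
apply: (le_trans fx); rewrite /red_norm le_max; apply/orP; right.
apply: (@le_trans _ _ (op_norm u f)); apply: ereal_sup_ubound.
  by exists d.
by exists u => //; exact: units_src.
Qed.

Lemma emb_norm_ge f x : Cc f -> `|f x| <= `|emb f|.
Proof.
move=> fC; rewrite (@normr_rnorm C) normr_rnorm /cplx lecR -lee_fin.
by rewrite (rc_emb_norm A fC); exact: modulus_le_red_norm.
Qed.

Lemma embB f g : Cc f -> Cc g -> emb (fun x => f x - g x) = emb f - emb g.
Proof.
move=> fC gC; rewrite -scaleN1r -(rc_embZ A) // -(rc_embD A)//; last exact: CcZ.
by congr (emb _); apply/funext => x; rewrite mulN1r.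
Qed.

Lemma emb0 : emb (fun=> 0) = 0.
Proof.
rewrite -[RHS](scale0r (emb (fun=> 0))) -(rc_embZ A)//; last exact: Cc0.
by congr (emb _); apply/funext => x; rewrite mul0r.
Qed.

Lemma emb_dense a (e : C) : 0 < e -> exists2 f, Cc f & `|a - emb f| <= e.
Proof.
move=> e0.
have [|b [/= ab [f fC fb]]] :=
  @rc_emb_dense R G A (ball a e)° _ (open_interior _).
  by exists a; apply: nbhsx_ballx.
exists f => //; rewrite fb; have := @interior_subset _ _ _ ab.
by rewrite -ball_normE => /ltW.
Qed.

Lemma emb_dist f g x : Cc f -> Cc g -> `|f x - g x| <= `|emb f - emb g|.
Proof.
move=> fC gC; rewrite -embB//; apply: (@emb_norm_ge (fun x => f x - g x)).
have := CcD fC (CcZ (-1) gC).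
by congr Cc; apply/funext => z; rewrite mulN1r.
Qed.

(** On functions in C_c(G), evaluation at x does not increase distances, so
    its values along the filter defining j are Cauchy; the bound passes to the
    limit.  All that is used of j follows from this estimate. *)
Lemma j_approx a f x : Cc f -> `|j a x - f x| <= `|a - emb f|.
Proof.
move=> fC; rewrite /j; set F := filter_from _ _.
have FF : ProperFilter F.
  apply: filter_from_proper; last first.
    move=> N; rewrite -nbhs_ballE => -[e /= e0 eN].
    have e20 : 0 < e / 2 by rewrite divr_gt0.
    have [g gC ag] := emb_dense a e20; exists g; split => //; apply: eN.
    rewrite -ball_normE /=; apply: le_lt_trans ag _.
    by rewrite ltr_pdivrMr// ltr_pMr// ltr1n.
  apply: filter_from_filter; first by exists setT; exact: filterT.
  move=> N M aN aM; exists (N `&` M); first exact: filterI.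
  by move=> g [gC [gN gM]].
have Fnear (e : C) : 0 < e -> F [set g | Cc g /\ `|a - emb g| < e].
  move=> e0; exists (ball a e); first exact: nbhsx_ballx.
  by move=> g /= [gC]; rewrite -ball_normE.
have [z Fz] : exists z : C, (fun g => g x) @ F --> z.
  apply: complex_cauchy_cvg => e e0.
  have e20 : 0 < e / 2 by rewrite divr_gt0.
  have [g gC ag] := emb_dense a e20; exists (g x).
  rewrite /nbhs /=; apply: filterS (Fnear _ e20) => h [hC ah].
  rewrite -ball_normE /=; apply: le_lt_trans (emb_dist x gC hC) _.
  apply: le_lt_trans (ler_distD a _ _) _.
  by rewrite [ltRHS](splitr e) distrC ler_ltD.
rewrite (cvg_lim _ Fz); last exact: (@norm_hausdorff C C).
apply/ler_addgt0Pr => e e0.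
have e20 : 0 < e / 2 by rewrite divr_gt0.
have /cvgrPdist_le /(_ _ e20) zF := Fz.
have [g [[gC ag] zg]] := filter_ex (filterI (Fnear _ e20) zF).
apply: le_trans (ler_distD (g x) _ _) _.
rewrite [e in leRHS](splitr e) addrCA; apply: lerD => //.
apply: le_trans (emb_dist x gC fC) _.
apply: le_trans (ler_distD a _ _) _.
by rewrite [leLHS]addrC lerD2l distrC ltW.
Qed.

Lemma j_emb f x : Cc f -> j (emb f) x = f x.
Proof.
move=> fC; apply/eqP; rewrite -subr_eq0 -normr_le0.
by have := j_approx (emb f) x fC; rewrite subrr normr0.
Qed.

Lemma j_linear c a b x : j (c *: a + b) x = c * j a x + j b x.
Proof.
apply/eqP; rewrite -subr_eq0 -normr_le0; apply/ler_addgt0Pr => e e0.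
rewrite add0r; pose k := `|c| + 1; pose d := e / (k + k).
have k0 : 0 < k by rewrite ltr_wpDl.
have d0 : 0 < d by rewrite divr_gt0// addr_gt0.
have [f fC af] := emb_dense a d0; have [g gC bg] := emb_dense b d0.
have hC := CcD (CcZ c fC) gC.
have kd : k * d + k * d = e by rewrite -mulrDl mulrC divfK// gt_eqF// addr_gt0.
rewrite -kd; apply: le_trans (ler_distD (c * f x + g x) _ _) _.
have split_le : forall (V : normedModType C) (u v u' v' : V),
    `|u - u'| <= d -> `|v - v'| <= d ->
    `|(c *: u + v) - (c *: u' + v')| <= k * d.
  move=> V u v u' v' uu' vv'; rewrite opprD addrACA -scalerBr.
  apply: le_trans (ler_normD _ _) _; rewrite normrZ /k mulrDl mul1r.
  by apply: lerD => //; exact: ler_wpM2l.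
apply: lerD.
  apply: le_trans (j_approx _ x hC) _; rewrite (rc_embD A)//; last exact: CcZ.
  by rewrite (rc_embZ A)//; exact: split_le.
rewrite distrC; apply: (split_le C^o (j a x) (j b x) (f x) (g x)).
  exact: le_trans (j_approx _ x fC) af.
exact: le_trans (j_approx _ x gC) bg.
Qed.

Lemma jB a b x : j (a - b) x = j a x - j b x.
Proof. by rewrite addrC -scaleN1r j_linear mulN1r addrC. Qed.

Lemma jD a b x : j (a + b) x = j a x + j b x.
Proof. by rewrite -[a]scale1r j_linear mul1r scale1r. Qed.

Lemma j0 x : j (0 : A) x = 0.
Proof. by rewrite -(subrr (0 : A)) jB subrr. Qed.

Lemma j_norm_le a x : `|j a x| <= `|a|.
Proof. by have := j_approx a x (@Cc0 R G); rewrite emb0 !subr0. Qed.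

Lemma eval_continuous x : continuous (fun a => j a x).
Proof.
apply: (@lipschitz_continuous_normed C A C^o _ 1) => // a b.
by rewrite mul1r -jB j_norm_le.
Qed.

Lemma j_continuous a : continuous (j a).
Proof.
move=> x; apply/cvgrPdist_le => e e0.
have e30 : 0 < e / 2 / 2 by rewrite !divr_gt0.
have [f fC af] := emb_dense a e30; have [fc _] := fC.
have /cvgrPdist_le/(_ (e / 2)) := fc x; rewrite divr_gt0// => /(_ isT).
apply: filterS => y fxy; apply: le_trans (ler_distD (f x) _ _) _.
have eE : e = e / 2 / 2 + (e / 2 + e / 2 / 2) by rewrite addrCA -!splitr.
rewrite [leRHS]eE; apply: lerD.
  exact: le_trans (j_approx _ x fC) af.
apply: le_trans (ler_distD (f y) _ _) _; apply: lerD => //.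
by rewrite distrC; exact: le_trans (j_approx _ y fC) af.
Qed.

(** The density argument that carries every formula for functions in C_c(G)
    over to the reduced algebra. *)
Lemma emb_dense_eq (F1 F2 : A -> C) : continuous F1 -> continuous F2 ->
  (forall f, Cc f -> F1 (emb f) = F2 (emb f)) -> F1 =1 F2.
Proof.
move=> c1 c2 F12 a.
have clF : closed [set a | F1 a = F2 a].
  exact: continuous_eq_closed (@norm_hausdorff C C) c1 c2.
have /clF : closure [set a | F1 a = F2 a] a; last by [].
move=> N; rewrite -nbhs_ballE => -[e /= e0 eN].
have e20 : 0 < e / 2 by rewrite divr_gt0.
have [f fC af] := emb_dense a e20; exists (emb f); split; first exact: F12.
apply: eN; rewrite -ball_normE /=; apply: le_lt_trans af _.
by rewrite ltr_pdivrMr// ltr_pMr// ltr1n.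
Qed.

End Evaluation.

(** * Continuity of the algebra operations *)

Section CstarContinuity.
Variables (R : realType) (B : cstarAlg R).
Implicit Types a b : B.

Lemma cs_mulBr a b b' : cs_mul a (b - b') = cs_mul a b - cs_mul a b'.
Proof. by rewrite -[- b']scaleN1r cs_mulDr cs_scaleAr scaleN1r. Qed.

Lemma cs_mulBl a a' b : cs_mul (a - a') b = cs_mul a b - cs_mul a' b.
Proof. by rewrite -[- a']scaleN1r cs_mulDl cs_scaleAl scaleN1r. Qed.

Lemma cs_mul_continuousr a : continuous (cs_mul a).
Proof.
apply: (@lipschitz_continuous_normed _ _ _ _ `|a|) => // b b'.
by rewrite -cs_mulBr cs_normM.
Qed.

Lemma cs_mul_continuousl b : continuous (fun a => cs_mul a b).
Proof.
apply: (@lipschitz_continuous_normed _ _ _ _ `|b|) => // a a'.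
by rewrite -cs_mulBl mulrC cs_normM.
Qed.

(** From |a|^2 = |a^* a| <= |a^*| |a|; as the adjoint is an involution, it is
    therefore isometric. *)
Lemma cs_norm_star_ge a : `|a| <= `|cs_star a|.
Proof.
have [->|a0] := eqVneq a 0; first by rewrite normr0.
have := cs_normM (cs_star a) a; rewrite cs_normC expr2.
by rewrite ler_pM2r// normr_gt0.
Qed.

Lemma cs_star_continuous : continuous (@cs_star R B).
Proof.
apply: (@lipschitz_continuous_normed _ _ _ _ 1) => // a b.
rewrite mul1r (_ : cs_star a - cs_star b = cs_star (a - b)).
  by rewrite -[X in _ <= `|X|]cs_starK cs_norm_star_ge.
by rewrite cs_starD -[- b]scaleN1r cs_starZ rmorphN1 scaleN1r.
Qed.

End CstarContinuity.

(** * Ideals and their spectra *)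

Section Ideals.
Variables (R : realType) (G : etaleGroupoid) (A : reducedCstar R G).
Local Notation C := (cplx R).
Implicit Types (f g : G -> C) (x y : G) (a b : A) (P W H U : set G) (I : set A).
Local Notation emb := (rc_emb A).

Lemma j_star a x : j (cs_star a) x = Num.conj (j a (ginv x)).
Proof.
move: a; apply: emb_dense_eq.
- by move=> a; apply: (@continuous_comp _ _ _
      (@cs_star R A) (fun b : A => j b x));
  [exact: cs_star_continuous | exact: eval_continuous].
- by move=> a; apply: (@continuous_comp _ _ _
      (fun b : A => j b (ginv x)) (@Num.conj C));
  [exact: eval_continuous | exact: conjC_continuous].
- by move=> f fC; rewrite -(rc_emb_star A)// !j_emb//; exact: Cc_involution.
Qed.

Lemma continuous_j_mulr b x : continuous (fun a : A => j (cs_mul a b) x).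
Proof.
by move=> a; apply: (@continuous_comp _ _ _
    (fun c : A => cs_mul c b) (fun c : A => j c x));
  [exact: cs_mul_continuousl | exact: eval_continuous].
Qed.

Lemma continuous_j_mull a x : continuous (fun b : A => j (cs_mul a b) x).
Proof.
by move=> b; apply: (@continuous_comp _ _ _ (cs_mul a) (fun c : A => j c x));
  [exact: cs_mul_continuousr | exact: eval_continuous].
Qed.

Lemma j_slice_mul W f b x y : rslice W -> Cc_on W f -> W y -> rng y = rng x ->
  j (cs_mul (emb f) b) x = f y * j b (gmul (ginv y) x).
Proof.
move=> sW fW Wy yx; have [fC fWs] := fW; move: b; apply: emb_dense_eq.
- exact: continuous_j_mull.
- by move=> b; apply: cvgM; [exact: cvg_cst | exact: eval_continuous].
have convC g : Cc g -> Cc (Defs.conv f g) := Cc_conv_slice sW fW.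
move=> g gC; rewrite -(rc_embM A)// !j_emb//; last exact: convC.
have [_ injW _] := sW; apply: (conv_slice _ injW _ Wy yx).
exact: (subset_trans (@subset_closure _ _) fWs).
Qed.

Lemma j_slice_mul0 W f b x : rslice W -> Cc_on W f ->
  (forall y, W y -> rng y <> rng x) -> j (cs_mul (emb f) b) x = 0.
Proof.
move=> sW fW Wx; have [fC fWs] := fW; move: b; apply: emb_dense_eq.
- exact: continuous_j_mull.
- by move=> b; exact: cvg_cst.
have convC g : Cc g -> Cc (Defs.conv f g) := Cc_conv_slice sW fW.
move=> g gC; rewrite -(rc_embM A)// j_emb//; last exact: convC.
apply/eqP; apply: contrapT => /negP/conv_supp[y [z [fy _ yz xE]]].
apply: (Wx y); last by rewrite xE rng_mul.
exact/fWs/supp_closure.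
Qed.

(** If b(x) is nonzero and f is a bump function at y on a slice, then
    (f b)(y x) = f(y) b(x) = b(x). *)
Lemma spectrum_left_invariant I : (forall a b, I b -> I (cs_mul a b)) ->
  gprod setT (spectrum I) `<=` spectrum I.
Proof.
move=> Il _ [y [x [_ [b Ib bx] yx ->]]].
have [W sW Wy] := rslice_ex y; have [oW _ _] := sW.
have [f [fW _ fy]] := @bump R G W y oW Wy.
exists (cs_mul (emb f) b); first exact: Il.
by rewrite (j_slice_mul _ sW fW Wy) ?rng_mul// fy mul1r gmulKl.
Qed.

Lemma spectrum_star I :
  spectrum [set a | I (cs_star a)] = (@ginv G) @^-1` spectrum I.
Proof.
apply/seteqP; split => x /= [a Ia ax].
  by exists (cs_star a) => //; rewrite j_star ginvK conjC_eq0.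
by exists (cs_star a); rewrite /= ?cs_starK// j_star conjC_eq0.
Qed.

(** The adjoint turns a right ideal into a left ideal and inverts the
    spectrum. *)
Lemma spectrum_right_invariant I : (forall a b, I a -> I (cs_mul a b)) ->
  gprod (spectrum I) setT `<=` spectrum I.
Proof.
move=> Ir _ [x [y [Ix _ xy ->]]].
rewrite -[gmul x y]ginvK -[spectrum I _]/((@ginv G @^-1` spectrum I) _).
rewrite -spectrum_star; apply: spectrum_left_invariant.
  by move=> a b /= Ib; rewrite cs_starM; exact: Ir.
exists (ginv y), (ginv x); split => //.
- by rewrite spectrum_star /= ginvK.
- by rewrite src_inv rng_inv.
- exact: ginvM.
Qed.

(** By density and decomposition into slices, it is enough to multiply b by a
    function f on a slice, and then (f b)(x) is a multiple of b(y^-1 x), where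
    y^-1 x is outside P because x is. *)
Lemma vanishing_off_left_ideal P : gprod setT P `<=` P ->
  forall a b, vanishing_off A P b -> vanishing_off A P (cs_mul a b).
Proof.
move=> GP a b Pb x nPx; move: a.
apply: (@emb_dense_eq _ _ A _ (fun=> 0)).
- exact: continuous_j_mulr.
- by move=> a; exact: cvg_cst.
apply: Cc_slice_ind.
- by rewrite emb0 -(subrr (0 : A)) cs_mulBl subrr j0.
- by move=> f g fC gC f0 g0; rewrite (rc_embD A)// cs_mulDl jD f0 g0 addr0.
move=> W f sW fW.
have [[y [Wy yx]]|nW] := pselect (exists y, W y /\ rng y = rng x); last first.
  by apply: (j_slice_mul0 _ sW fW) => y Wy yx; apply: nW; exists y.
rewrite (j_slice_mul _ sW fW Wy yx) Pb ?mulr0// => Pyx; apply: nPx; apply: GP.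
exists y, (gmul (ginv y) x); split => //.
  by rewrite rng_mul ?rng_inv ?src_inv.
by rewrite gmulVKl.
Qed.

Lemma vanishing_off_star P a :
  vanishing_off A P (cs_star a) <-> vanishing_off A ((@ginv G) @^-1` P) a.
Proof.
split=> Pa x nPx.
  by apply/eqP; rewrite -conjC_eq0 -[x]ginvK -j_star; apply/eqP/Pa.
by rewrite j_star Pa ?conjC0//= ginvK.
Qed.

Lemma vanishing_off_right_ideal P : gprod P setT `<=` P ->
  forall a b, vanishing_off A P a -> vanishing_off A P (cs_mul a b).
Proof.
move=> PG a b; rewrite -{1}[a]cs_starK -[cs_mul a b]cs_starK.
rewrite (vanishing_off_star P (cs_star a)).
rewrite (vanishing_off_star P (cs_star (cs_mul a b))) cs_starM.
apply: vanishing_off_left_ideal.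
move=> _ [x [y [_ Py xy ->]]] /=; apply: PG; rewrite ginvM//.
by exists (ginv y), (ginv x); split => //; rewrite src_inv rng_inv.
Qed.

Lemma vanishing_off_closed_subspace P : closed_subspace (vanishing_off A P).
Proof.
split.
- rewrite (_ : vanishing_off A P = \bigcap_(x in ~` P) [set a | j a x = 0]) //.
  apply: closed_bigI => x _; apply: continuous_eq_closed => //.
  + exact: eval_continuous.
  + by move=> a; exact: cvg_cst.
- by move=> x _; exact: j0.
- by move=> c a b Pa Pb x nPx; rewrite j_linear Pa// Pb// mulr0 addr0.
Qed.

Lemma vanishing_off_closed_ideal H : mul_invariant H ->
  closed_ideal (vanishing_off A H).
Proof.
move=> [HG GH]; split; first exact: vanishing_off_closed_subspace.
by move=> a b Ha; split;
  [exact: vanishing_off_right_ideal | exact: vanishing_off_left_ideal].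
Qed.

Lemma vanishing_offS P H : P `<=` H -> vanishing_off A P `<=` vanishing_off A H.
Proof. by move=> PH a Pa x nHx; apply: Pa => /PH. Qed.

Lemma spectrumS I J : I `<=` J -> spectrum I `<=` spectrum J.
Proof. by move=> IJ x [a Ia ax]; exists a => //; exact: IJ. Qed.

Lemma sub_vanishing_off_spectrum I : I `<=` vanishing_off A (spectrum I).
Proof.
move=> a Ia x nIx; apply/eqP; apply: contrapT => /negP ax.
by apply: nIx; exists a.
Qed.

Lemma open_spectrum I : open (spectrum I).
Proof.
rewrite (_ : spectrum I = \bigcup_(a in I) supp' (j a)) //.
by apply: bigcup_open => a _; apply: open_supp; exact: j_continuous.
Qed.

(** Every point of an open set P carries a bump function supported in P. *)
Lemma spectrum_vanishing_off P : open P -> spectrum (vanishing_off A P) = P.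
Proof.
move=> oP; apply/seteqP; split => x.
  by move=> [a Pa ax]; apply: contrapT => /Pa /eqP; apply/negP.
move=> Px; have [f [[fC fP] _ fx]] := @bump R G P x oP Px.
exists (emb f); last by rewrite j_emb// fx oner_neq0.
move=> y nPy; rewrite j_emb//; apply: (off_supp0 _ nPy).
exact: (subset_trans (@subset_closure _ _) fP).
Qed.

Lemma spectrum_mul_invariant I : closed_ideal I -> mul_invariant (spectrum I).
Proof.
move=> [_ Iid]; split.
  by apply: spectrum_right_invariant => a b Ia; have [] := Iid a b Ia.
by apply: spectrum_left_invariant => a b Ib; have [] := Iid b a Ib.
Qed.

Lemma Cc_closure_sub P : @Cc_closure R G A P `<=` vanishing_off A P.
Proof.
have [clP _ _] := vanishing_off_closed_subspace P.
rewrite [X in _ `<=` X](closure_id _).1//; apply: closureS.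
move=> _ [f [fC fP] <-] x nPx; rewrite j_emb//; apply: (off_supp0 _ nPx).
exact: (subset_trans (@subset_closure _ _) fP).
Qed.

(** An element that vanishes off P has its open support in P, and the
    approximation property puts it in the closure of C_c of that support. *)
Lemma Cc_closureE P : fourier_approximation A ->
  @Cc_closure R G A P = vanishing_off A P.
Proof.
move=> fcap; apply/seteqP; split; first exact: Cc_closure_sub.
move=> a Pa; have := fcap a; rewrite /Cc_closure; apply: closureS.
move=> _ [f [fC fa] <-]; exists f => //; split => // x /fa ax.
by apply: contrapT => /Pa /eqP; apply/negP.
Qed.

End Ideals.

(** * Sets that absorb multiplication *)

Section InvariantSubsets.
Variable G : etaleGroupoid.
Implicit Types (H U : set G).

Lemma mul_invariant_inv H x : mul_invariant H -> H x -> H (ginv x).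
Proof.
move=> [HG GH] Hx.
have Hs : H (src x).
  by apply: GH; exists (ginv x), x; split; rewrite ?src_inv ?gmulVg.
apply: HG; exists (src x), (ginv x); split; rewrite ?src_src ?rng_inv//.
by rewrite -(rng_inv x) gmul_unitl.
Qed.

Lemma mul_invariant_src H x : mul_invariant H -> H (src x) <-> H x.
Proof.
move=> [HG GH]; split => Hx; apply: GH.
  by exists x, (src x); split; rewrite ?rng_src ?gmul_unitr.
by exists (ginv x), x; split; rewrite ?src_inv ?gmulVg.
Qed.

Lemma mul_invariant_subgroupoid H : mul_invariant H -> subgroupoid H.
Proof.
move=> Hm; split; last by move=> x; exact: mul_invariant_inv.
by move=> x y Hx Hy xy; have [HG _] := Hm; apply: HG; exists x, y.
Qed.

Lemma mul_invariant_rng H x : mul_invariant H -> H (rng x) <-> H x.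
Proof.
move=> Hm; rewrite -src_inv mul_invariant_src//.
split; last exact: mul_invariant_inv.
by move=> /(mul_invariant_inv Hm); rewrite ginvK.
Qed.

(** A set absorbing multiplication contains an arrow as soon as it contains its
    source or its range, so it is determined by its units. *)
Lemma reduction_mul_invariantE H : mul_invariant H ->
  reduction (H `&` units G) = H.
Proof.
move=> Hm; apply/seteqP; split => x; rewrite /reduction /=.
  by move=> [[/mul_invariant_src +  _] _]; apply.
move=> Hx; split; split; [exact/mul_invariant_src | exact: units_src |
  exact/mul_invariant_rng | exact: units_rng].
Qed.

Lemma mul_invariant_units H : mul_invariant H -> Defs.invariant (H `&` units G).
Proof.
move=> Hm; split; first exact: subIsetr.
apply/seteqP; split => x /=.
  move=> [Hx [y _ yx]]; exists x; last by rewrite -yx rng_src.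
  by rewrite -yx src_src yx; split => //; exists y.
by move=> [y [/(mul_invariant_src _ Hm) Hy _] <-]; split;
  [exact/mul_invariant_rng | exact: units_rng].
Qed.

Lemma invariant_mul_invariant U : Defs.invariant U -> mul_invariant (reduction U).
Proof.
move=> [_ UE].
have Ur y : U (src y) -> U (rng y) by move=> Uy; rewrite UE; exists y.
have Us y : U (rng y) -> U (src y).
  by have := Ur (ginv y); rewrite src_inv rng_inv.
split=> _ [x [y [xP yP xy ->]]]; rewrite /reduction /= src_mul// rng_mul//.
  by have [? ?] := xP; split => //; apply: Us; rewrite -xy.
by have [? ?] := yP; split => //; apply: Ur; rewrite xy.
Qed.

Lemma open_reduction U : rel_open (units G) U -> open (reduction U).
Proof.
move=> oU; apply: openI.
  exact: (rel_open_preimage (@src_continuous G) (@units_src G) oU).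
exact: (rel_open_preimage (@rng_continuous G) (@units_rng G) oU).
Qed.

End InvariantSubsets.

(** * The correspondence *)

Lemma dynamical_idealP (R : realType) (G : etaleGroupoid) (A : reducedCstar R G)
    (I : set A) : fourier_approximation A ->
  dynamical_ideal I <->
  exists H : set G, [/\ open H, mul_invariant H & I = vanishing_off A H].
Proof.
move=> fcap; split=> [[_ [U [oU Ui ->]]]|[H [oH Hm ->]]].
  exists (reduction U); split; first exact: open_reduction.
    exact: invariant_mul_invariant.
  exact: Cc_closureE.
split; first exact: vanishing_off_closed_ideal.
exists (H `&` units G); split; first by exists H.
  exact: mul_invariant_units.
by rewrite reduction_mul_invariantE// Cc_closureE.
Qed.

Theorem theorem3p23 (R : realType) (G : etaleGroupoid) (A : reducedCstar R G)
    (fcap : fourier_approximation A) :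
  (forall I : set A, closed_ideal I ->
     [/\ dynamical_ideal (vanishing_off A (spectrum I)),
         I `<=` vanishing_off A (spectrum I),
         (forall J : set A, dynamical_ideal J -> I `<=` J ->
            vanishing_off A (spectrum I) `<=` J) &
         spectral I <-> dynamical_ideal I]) /\
  set_bij [set H : set G | [/\ open H, subgroupoid H & mul_invariant H]]
          [set I : set A | dynamical_ideal I]
          (vanishing_off A).
Proof.
split.
  move=> I Iid.
  have dI : dynamical_ideal (vanishing_off A (spectrum I)).
    apply/(dynamical_idealP _ fcap); exists (spectrum I); split => //.
      exact: open_spectrum.
    exact: spectrum_mul_invariant.
  split => //; first exact: sub_vanishing_off_spectrum.
    move=> J /(dynamical_idealP _ fcap)[H [oH _ ->]] /spectrumS.
    by rewrite spectrum_vanishing_off//; exact: vanishing_offS.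
  split=> [[_ ->]//|/(dynamical_idealP _ fcap)[H [oH _ IE]]]; split; last first.
    by rewrite IE spectrum_vanishing_off.
  by have [Is Iab] := Iid; split => // a b Ia _; exact: Iab.
split.
- move=> H [oH _ Hm] /=; apply/(dynamical_idealP _ fcap).
  by exists H.
- move=> H K; rewrite !inE => -[oH _ _] [oK _ _] HK.
  by rewrite -(spectrum_vanishing_off A oH) HK spectrum_vanishing_off.
- move=> I /(dynamical_idealP _ fcap)[H [oH Hm ->]]; exists H => //.
  by split => //; exact: mul_invariant_subgroupoid.
Qed.
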